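(* Let $m,n\ge1$ and let $\mathcal{S}=[s_0,s_1,\ldots,s_{k-1}]$ be a binary $(mn,R)$-covering sequence of length $k$, where $n$ divides $k$. Let $M=k/n$ and let $\mathcal{A}'$ be the $M\times(2n-1)$ binary array whose $j$-th row, $0\le j\le M-1$, is $$s_{jn+1},s_{jn+2},\ldots,s_{jn+n},s_{jn+n+1},\ldots,s_{jn+2n-1},$$ with indices taken modulo $k$. Then $\mathcal{A}'$ is an $(m\times n,R)$-covering 2D-sequence.
   Context: A cyclic binary sequence of length $k$ has as its windows of length $N$ the words $(s_i,\ldots,s_{i+N-1})$, $0\le i\le k-1$, indices modulo $k$; it is an $(N,R)$-covering sequence if every $x\in\{0,1\}^N$ is within Hamming distance $R$ of some window. An $M\times N$ binary array $A=(A_{r,c})$ is regarded as doubly periodic (a torus); its $m\times n$ windows are the $m\times n$ arrays $(A_{(r+a)\bmod M,\,(c+b)\bmod N})_{0\le a<m,\,0\le b<n}$ for $0\le r<M$, $0\le c<N$. It is an $(m\times n,R)$-covering 2D-sequence if for every binary $m\times n$ matrix $B$ there is a window $X$ with $d(B,X)\le R$, where $d$ counts the entries in which two matrices differ. *)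

(* Defs.v *)
From mathcomp Require Import all_boot all_order all_algebra.

Set Implicit Arguments.
Unset Strict Implicit.
Unset Printing Implicit Defensive.

Definition word_dist (N : nat) (x y : N.-tuple bool) : nat :=
  #|[set i : 'I_N | tnth x i != tnth y i]|.

Definition mx_dist (m n : nat) (X Y : 'M[bool]_(m, n)) : nat :=
  #|[set p : 'I_m * 'I_n | X p.1 p.2 != Y p.1 p.2]|.

(* s_i with the index i taken modulo k.  The default value [false] of [nth] is
   only reached when k = 0, in which case s has no window at all. *)
Definition cyc_nth (k : nat) (s : k.-tuple bool) (i : nat) : bool :=
  nth false s (i %% k).

(* The window of length N may be longer than the period k. *)
Definition window (k : nat) (s : k.-tuple bool) (N : nat) (i : 'I_k) :
    N.-tuple bool :=
  [tuple cyc_nth s (i + a) | a < N].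

Definition covering_sequence (N R k : nat) (s : k.-tuple bool) : Prop :=
  forall x : N.-tuple bool, exists i : 'I_k, word_dist x (window s N i) <= R.

(* (i + a) mod k as an element of 'I_k; the argument i witnesses 0 < k. *)
Definition cyc_shift (k : nat) (i : 'I_k) (a : nat) : 'I_k :=
  Ordinal (ltn_pmod (i + a) (leq_ltn_trans (leq0n i) (ltn_ord i))).

Definition window2D (M N : nat) (A : 'M[bool]_(M, N)) (m n : nat)
    (r : 'I_M) (c : 'I_N) : 'M[bool]_(m, n) :=
  \matrix_(a < m, b < n) A (cyc_shift r a) (cyc_shift c b).

Definition covering_2Dsequence (m n R M N : nat) (A : 'M[bool]_(M, N)) : Prop :=
  forall B : 'M[bool]_(m, n),
    exists (r : 'I_M) (c : 'I_N), mx_dist B (window2D A m n r c) <= R.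

(* Row j is s_{jn+1}, ..., s_{jn+2n-1}; columns are numbered from 0, whence
   the offset 1. *)
Definition folded_array (n k : nat) (s : k.-tuple bool) :
    'M[bool]_(k %/ n, 2 * n - 1) :=
  \matrix_(j < k %/ n, c < 2 * n - 1) cyc_nth s (j * n + 1 + c).

(* Main.v *)
(* Cut a word of length m * n into m rows of length n.  If i - 1 = q * n + c
   modulo k with c < n, the word s_i, ..., s_(i + m * n - 1) cut in this way is
   the window of the array at row q and column c: it meets the columns
   c, ..., c + n - 1 <= 2 * n - 2 only, so there is no wrap-around in the rows,
   and the wrap-around in the columns is reduction modulo (k / n) * n = k. *)

Require Import Defs.
From mathcomp Require Import all_boot all_order all_algebra.
From mathcomp Require Import zify.

Lemma flat_index_subproof {m n : nat} (p : 'I_m * 'I_n) :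
  p.1 * n + p.2 < m * n.
Proof. by case: p => [[a ha] [b hb]] /=; nia. Qed.

Definition flat_index {m n : nat} (p : 'I_m * 'I_n) : 'I_(m * n) :=
  Ordinal (flat_index_subproof p).

Lemma flat_index_inj {m n : nat} : injective (@flat_index m n).
Proof.
move=> [a b] [a' b'] /(congr1 val) /= e.
have n0 : 0 < n by case: b {e} => b; case: n b'.
have ea : a = a'.
  apply: val_inj; move: (congr1 (divn^~ n) e) => /=.
  by rewrite !divnMDl // !divn_small // !addn0.
have eb : b = b'.
  apply: val_inj; move: (congr1 (modn^~ n) e) => /=.
  by rewrite !modnMDl !modn_small.
by rewrite ea eb.
Qed.

(** The injection [flat_index] sends each entry where [X] and [Y] differ to a position where [x] and
    [y] differ. *)
Lemma mx_dist_le_word_dist {m n : nat} (X Y : 'M[bool]_(m, n))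
    (x y : (m * n).-tuple bool) :
  (forall p, X p.1 p.2 = tnth x (flat_index p)) ->
  (forall p, Y p.1 p.2 = tnth y (flat_index p)) ->
  mx_dist X Y <= word_dist x y.
Proof.
move=> hX hY; rewrite /mx_dist -(card_imset _ flat_index_inj).
apply/subset_leq_card/subsetP => t /imsetP[p hp ->].
by move: hp; rewrite !inE hX hY.
Qed.

Lemma flatten_mx {m n : nat} (B : 'M[bool]_(m, n)) :
  exists x : (m * n).-tuple bool, forall p, B p.1 p.2 = tnth x (flat_index p).
Proof.
(* The existential selects the entry of [B] at the preimage of [t], so no inverse of [flat_index]
   has to be built. *)
exists [tuple [exists p, (flat_index p == t) && B p.1 p.2] | t < m * n] => p.
rewrite tnth_mktuple; apply/idP/existsP => [Bp | [p' /andP[/eqP]]].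
  by exists p; rewrite eqxx.
by move=> /flat_index_inj ->.
Qed.

Lemma cyc_nth_mod {k : nat} (s : k.-tuple bool) (i j : nat) :
  i = j %[mod k] -> cyc_nth s i = cyc_nth s j.
Proof. by rewrite /cyc_nth => ->. Qed.

Theorem theorem6 (m n R k : nat) (s : k.-tuple bool)
    (hm : 1 <= m) (hn : 1 <= n) (hnk : n %| k)
    (hs : covering_sequence (m * n) R s) :
  covering_2Dsequence m n R (folded_array n s).
Proof.
move=> B; have [x hx] := flatten_mx B; have [i hi] := hs x.
have k0 : 0 < k by apply: leq_ltn_trans (ltn_ord i).
(* This is [i - 1] modulo [k], undoing the offset 1 of the array; adding [k.-1] avoids truncated
   subtraction at [i = 0]. *)
pose i' := (i + k.-1) %% k.
have hq : i' %/ n < k %/ n by rewrite ltn_divLR // divnK // ltn_pmod.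
have cn : i' %% n < n by rewrite ltn_pmod.
have hc : i' %% n < 2 * n - 1 by lia.
exists (Ordinal hq), (Ordinal hc).
apply: leq_trans hi; apply: mx_dist_le_word_dist => // -[a b] /=.
rewrite tnth_mktuple !mxE /=; apply: cyc_nth_mod.
have bn := ltn_ord b.
rewrite (modn_small (m := i' %% n + b)); last by lia.
(* The row index modulo [k %/ n], times [n], is a residue modulo [k %/ n * n = k]. *)
rewrite muln_modl divnK // -addnA modnDml.
have -> : (i' %/ n + a) * n + (1 + (i' %% n + b)) = i' + (1 + (a * n + b)).
  by rewrite {3}(divn_eq i' n); lia.
rewrite /i' modnDml.
have -> : i + k.-1 + (1 + (a * n + b)) = k + (i + (a * n + b)) by lia.
by rewrite modnDl.
Qed.
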